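(* Let $\mathfrak{B}_3:\mathbb{R}^2\to\mathbb{R}^3$ be Bour's minimal surface of value $3$, $$\mathfrak{B}_3(u,v)=\left(-\tfrac{u^4}{4}-\tfrac{v^4}{4}+\tfrac32u^2v^2+\tfrac{u^2}{2}-\tfrac{v^2}{2},\; -u^3v+uv^3-uv,\; \tfrac23u^3-2uv^2\right).$$ In the inhomogeneous tangential coordinates $\overline{u},\overline{v},\overline{w}$, the irreducible implicit equation of $\mathfrak{B}_3$ is \begin{align*}&9\overline{u}^{8}+72\overline{u}^{7}+144\overline{u}^{6}+288\overline{u}^{5}\overline{w}^{2}+192\overline{u}^{3}\overline{w}^{4}+8\overline{u}^{6}\overline{w}^{2}-48\overline{u}^{4}\overline{v}^{2}\overline{w}^{2}-576\overline{u}\,\overline{v}^{2}\overline{w}^{4}\\&+81\overline{u}^{2}\overline{v}^{6}+432\overline{u}^{4}\overline{v}^{2}-45\overline{u}^{6}\overline{v}^{2}-72\overline{u}^{5}\overline{v}^{2}+432\overline{u}^{2}\overline{v}^{4}-360\overline{u}^{3}\overline{v}^{4}-216\overline{u}\,\overline{v}^{6}+27\overline{u}^{4}\overline{v}^{4}\\&+144\overline{v}^{6}-576\overline{u}^{3}\overline{v}^{2}\overline{w}^{2}+72\overline{u}^{2}\overline{v}^{4}\overline{w}^{2}-864\overline{u}\,\overline{v}^{4}\overline{w}^{2}=0.\end{align*} Consequently the class of $\mathfrak{B}_3$ is $cl(\mathfrak{B}_3)=8$.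
   Context: For a parametrized surface $\mathbf{x}(u,v)=(x(u,v),y(u,v),z(u,v))$ in $\mathbb{R}^3$ with Gauss map $n=(X(u,v),Y(u,v),Z(u,v))$, write the tangent plane at the parameter $(u,v)$ as the set of points $(x,y,z)$ with $X(u,v)x+Y(u,v)y+Z(u,v)z+P(u,v)=0$, so that $P(u,v)=-\langle n(u,v),\mathbf{x}(u,v)\rangle$. The inhomogeneous tangential coordinates are $\overline{u}=X/P$, $\overline{v}=Y/P$, $\overline{w}=Z/P$ (defined where $P\neq0$). The implicit equation in tangential coordinates is obtained by eliminating $u,v$: it is $g=0$, where $g\in\mathbb{R}[\overline{u},\overline{v},\overline{w}]$ is the irreducible polynomial (unique up to a nonzero constant factor) with $g(\overline{u}(u,v),\overline{v}(u,v),\overline{w}(u,v))=0$ for all $(u,v)$ with $P(u,v)\ne0$. The class $cl$ of the surface is the total degree of $g$. For the surface considered here the Gauss map is $$n=\left(\frac{2u}{u^2+v^2+1},\frac{2v}{u^2+v^2+1},\frac{u^2+v^2-1}{u^2+v^2+1}\right).$$ *)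

(* Defs.v *)
From mathcomp Require Import all_boot all_order all_algebra.
From mathcomp Require Import classical_sets reals.
From mathcomp Require Import mpoly.

Set Implicit Arguments.
Unset Strict Implicit.
Unset Printing Implicit Defensive.

Import GRing.Theory.
Local Open Scope ring_scope.

Definition row3 (R : realType) (a b c : R) : 'rV[R]_3 :=
  \row_(i < 3) [:: a; b; c]`_i.

Definition irreducible (A : idomainType) (a : A) : Prop :=
  [/\ a != 0, a \isn't a GRing.unit
    & forall b c : A, a = b * c -> b \is a GRing.unit \/ c \is a GRing.unit].

(* Below, x is a parametrized surface and n its Gauss map, not necessarily
   defined through the cross product so that branch points are allowed. *)

Definition tangentP (R : realType) (x n : R -> R -> 'rV[R]_3) (u v : R) : R :=
  - \sum_(i < 3) n u v 0 i * x u v 0 i.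

(* (X / P, Y / P, Z / P), meaningful only where P != 0 *)
Definition tangential_coords (R : realType) (x n : R -> R -> 'rV[R]_3)
    (u v : R) : 'I_3 -> R :=
  fun i => n u v 0 i / tangentP x n u v.

Definition vanishes_on_tangential (R : realType) (x n : R -> R -> 'rV[R]_3)
    (g : {mpoly R[3]}) : Prop :=
  forall u v : R, tangentP x n u v != 0 -> g.@[tangential_coords x n u v] = 0.

(* g = 0 is the implicit equation: g is the irreducible polynomial vanishing at
   the tangential coordinates, uniqueness up to a constant being included *)
Definition is_tangential_equation (R : realType) (x n : R -> R -> 'rV[R]_3)
    (g : {mpoly R[3]}) : Prop :=
  [/\ irreducible g, vanishes_on_tangential x n g
    & forall h : {mpoly R[3]}, irreducible h -> vanishes_on_tangential x n h ->
        exists2 c : R, c != 0 & h = c *: g].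

(* msize is the total degree plus one; the value does not depend on the g picked
   by xget, and is the junk value 0 if the surface has no implicit equation *)
Definition surface_class (R : realType) (x n : R -> R -> 'rV[R]_3) : nat :=
  (msize (xget 0 [set g | is_tangential_equation x n g]%classic)).-1.

Definition bour3 (R : realType) (u v : R) : 'rV[R]_3 :=
  row3 (- (u ^+ 4 / 4) - v ^+ 4 / 4 + 3 / 2 * u ^+ 2 * v ^+ 2
          + u ^+ 2 / 2 - v ^+ 2 / 2)
       (- (u ^+ 3 * v) + u * v ^+ 3 - u * v)
       (2 / 3 * u ^+ 3 - 2 * u * v ^+ 2).

Definition bour3_gauss (R : realType) (u v : R) : 'rV[R]_3 :=
  row3 (2 * u / (u ^+ 2 + v ^+ 2 + 1))
       (2 * v / (u ^+ 2 + v ^+ 2 + 1))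
       ((u ^+ 2 + v ^+ 2 - 1) / (u ^+ 2 + v ^+ 2 + 1)).

Definition bour3_poly (R : realType) : {mpoly R[3]} :=
  let u : {mpoly R[3]} := 'X_(inord 0) in
  let v : {mpoly R[3]} := 'X_(inord 1) in
  let w : {mpoly R[3]} := 'X_(inord 2) in
  9 * u ^+ 8 + 72 * u ^+ 7 + 144 * u ^+ 6 + 288 * u ^+ 5 * w ^+ 2
  + 192 * u ^+ 3 * w ^+ 4 + 8 * u ^+ 6 * w ^+ 2
  - 48 * u ^+ 4 * v ^+ 2 * w ^+ 2 - 576 * u * v ^+ 2 * w ^+ 4
  + 81 * u ^+ 2 * v ^+ 6 + 432 * u ^+ 4 * v ^+ 2 - 45 * u ^+ 6 * v ^+ 2
  - 72 * u ^+ 5 * v ^+ 2 + 432 * u ^+ 2 * v ^+ 4 - 360 * u ^+ 3 * v ^+ 4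
  - 216 * u * v ^+ 6 + 27 * u ^+ 4 * v ^+ 4
  + 144 * v ^+ 6 - 576 * u ^+ 3 * v ^+ 2 * w ^+ 2
  + 72 * u ^+ 2 * v ^+ 4 * w ^+ 2 - 864 * u * v ^+ 4 * w ^+ 2.

(* Main.v *)
From HB Require Import structures.
Require Import Defs.
From mathcomp Require Import all_boot all_order all_algebra.
From mathcomp Require Import boolp classical_sets reals.
From mathcomp Require Import mpoly.
From mathcomp Require Import ring lra.
Set Implicit Arguments.
Unset Strict Implicit.
Unset Printing Implicit Defensive.
Local Open Scope ring_scope.
Import Order.TTheory GRing.Theory Num.Theory.

(* Let I be the ideal of the polynomials vanishing at the tangential coordinates
   and g the polynomial of the statement. With s = u^2 + v^2 one finds
   P = - u (u^2 - 3 v^2) (s + 2) / (6 (s + 1)), and g lies in I. The ideal I is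
   prime: along the segment between two parameters the coordinates are rational
   functions of one variable. Hence it suffices to show that g divides every h in
   I, which gives irreducibility, uniqueness and, with deg g = 8, the class.

   As a polynomial in w, g = A w^4 + B w^2 + C with A = 192 x (x^2 - 3 y^2).
   Pseudo-division of h by g leaves a remainder r in I of degree < 4 in w. Since
   (u, v) -> (- u, - v) fixes x, y and negates w, the even and odd parts of r
   yield relations a + b w^2 = 0 with a, b depending on x and y only. When the
   ratio t = v / u is fixed, x, y and w^2 are rational functions of s, and the
   substitution s -> - 2 - s fixes x, y but not w^2; hence a = b = 0 and r = 0.
   So g divides A^k h. The linear factors x and x -+ sqrt 3 y of A are prime and
   do not divide g, so they can be cancelled. *)

(** * Rational functions of one variable *)

Lemma poly_vanishing_seq (R : idomainType) (p : {poly R}) (s : nat -> R) :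
  injective s -> (forall i, p.[s i] = 0) -> p = 0.
Proof.
move=> s_inj p0; apply/eqP; apply: contraT => p_neq0.
have us : uniq (map s (iota 0 (size p))) by rewrite map_inj_uniq ?iota_uniq.
have rs : all (root p) (map s (iota 0 (size p))).
  by apply/allP => _ /mapP[i _ ->]; apply/rootP/p0.
by have := max_poly_roots p_neq0 rs us; rewrite size_map size_iota ltnn.
Qed.

Lemma poly_vanishing_right (R : realDomainType) (p : {poly R}) (b : R) :
  (forall a, b < a -> p.[a] = 0) -> p = 0.
Proof.
move=> p0; apply: (@poly_vanishing_seq _ p (fun i => b + i.+1%:R)) => [i j|i].
  by move=> /addrI /eqP; rewrite eqr_nat => /eqP[].
by rewrite p0 // ltrDl ltr0n.
Qed.

Lemma poly_vanishing_left (R : realDomainType) (p : {poly R}) (b : R) :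
  (forall a, a < b -> p.[a] = 0) -> p = 0.
Proof.
move=> p0; apply: (@poly_vanishing_seq _ p (fun i => b - i.+1%:R)) => [i j|i].
  by move=> /addrI /oppr_inj /eqP; rewrite eqr_nat => /eqP[].
by rewrite p0 // gtrDl oppr_lt0 ltr0n.
Qed.

Section RationalFunctions.
Variables (R : realFieldType) (D : {poly R}).

(** Nothing is required where [D] vanishes, so the default values of division there are harmless.
    Allowing any power of one fixed [D] makes the class closed under sums and products. *)
Definition ratfun (f : R -> R) : Prop :=
  exists (N : nat) (F : {poly R}),
    forall a, D.[a] != 0 -> f a * D.[a] ^+ N = F.[a].

Lemma ratfunC c : ratfun (fun=> c).
Proof. by exists 0%N, c%:P => a _; rewrite expr0 mulr1 hornerC. Qed.

Lemma ratfunD f g : ratfun f -> ratfun g -> ratfun (fun a => f a + g a).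
Proof.
move=> [n [F fF]] [m [G gG]]; exists (n + m)%N, (F * D ^+ m + G * D ^+ n) => a Da.
by rewrite hornerD !hornerM !horner_exp -fF // -gG // exprD; ring.
Qed.

Lemma ratfunM f g : ratfun f -> ratfun g -> ratfun (fun a => f a * g a).
Proof.
move=> [n [F fF]] [m [G gG]]; exists (n + m)%N, (F * G) => a Da.
by rewrite hornerM -fF // -gG // exprD; ring.
Qed.

Lemma ratfunX f n : ratfun f -> ratfun (fun a => f a ^+ n).
Proof.
move=> rf; elim: n => [|n IHn]; first exact: (ratfunC 1).
have [N [F fF]] := ratfunM rf IHn.
by exists N, F => a Da; rewrite exprS fF.
Qed.

Lemma ratfun_div (p : {poly R}) f :
  (forall a, D.[a] != 0 -> f a = p.[a] / D.[a]) -> ratfun f.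
Proof.
by move=> fE; exists 1%N, p => a Da; rewrite expr1 fE // divfK.
Qed.

Lemma ratfun_sum (I : Type) (r : seq I) (f : I -> R -> R) :
  (forall i, ratfun (f i)) -> ratfun (fun a => \sum_(i <- r) f i a).
Proof.
move=> rf; elim: r => [|i r IHr].
  by exists 0%N, 0 => a _; rewrite big_nil mul0r horner0.
have [N [F fF]] := ratfunD (rf i) IHr.
by exists N, F => a Da; rewrite big_cons fF.
Qed.

Lemma ratfun_prod (I : Type) (r : seq I) (f : I -> R -> R) :
  (forall i, ratfun (f i)) -> ratfun (fun a => \prod_(i <- r) f i a).
Proof.
move=> rf; elim: r => [|i r IHr].
  by exists 0%N, 1 => a _; rewrite big_nil mul1r expr0 hornerC.
have [N [F fF]] := ratfunM (rf i) IHr.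
by exists N, F => a Da; rewrite big_cons fF.
Qed.

Lemma ratfun_meval n (p : {mpoly R[n]}) (f : R -> 'I_n -> R) :
  (forall i, ratfun (fun a => f a i)) -> ratfun (fun a => p.@[f a]).
Proof.
move=> rf; have [N [F fF]] : ratfun (fun a =>
    \sum_(m <- msupp p) p@_m * \prod_i f a i ^+ m i).
  apply: ratfun_sum => m; apply: ratfunM; first exact: ratfunC.
  by apply: ratfun_prod => i; apply: ratfunX.
by exists N, F => a Da; rewrite mevalE fF.
Qed.

Lemma ratfun_horner2 (p : {poly {poly R}}) (f g : R -> R) :
  ratfun f -> ratfun g -> ratfun (fun a => p.[(f a)%:P].[g a]).
Proof.
move=> rf rg.
have rhorner (q : {poly R}) : ratfun (fun a => q.[g a]).
  elim/poly_ind: q => [|q c rq].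
    by exists 0%N, 0 => a _; rewrite !horner0 mul0r.
  have [N [F fF]] := ratfunD (ratfunM rq rg) (ratfunC c).
  by exists N, F => a Da; rewrite hornerMXaddC fF.
elim/poly_ind: p => [|p c rp].
  by exists 0%N, 0 => a _; rewrite !horner0 mul0r.
have [N [F fF]] := ratfunD (ratfunM rp rf) (rhorner c).
by exists N, F => a Da; rewrite hornerMXaddC hornerD hornerM hornerC fF.
Qed.

Hypothesis D_neq0 : D != 0.

(** The product of both numerators and [D] has infinitely many roots, so one numerator is the zero
    polynomial. This is the source of the primality of the vanishing ideal. *)
Lemma ratfun_mulf_eq0 f g : ratfun f -> ratfun g ->
  (forall a, D.[a] != 0 -> f a * g a = 0) ->
  (forall a, D.[a] != 0 -> f a = 0) \/ (forall a, D.[a] != 0 -> g a = 0).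
Proof.
move=> [n [F fF]] [m [G gG]] fg0.
have /eqP : F * G * D = 0.
  apply: (@poly_vanishing_right R _ 0) => a _; rewrite !hornerM.
  have [->|Da] := eqVneq D.[a] 0; first by rewrite mulr0.
  by rewrite -fF // -gG // mulrACA fg0 // !mul0r.
rewrite !mulf_eq0 (negPf D_neq0) orbF => /orP[] /eqP E; [left|right] => a Da.
  by apply: (mulIf (expf_neq0 n Da)); rewrite mul0r fF // E horner0.
by apply: (mulIf (expf_neq0 m Da)); rewrite mul0r gG // E horner0.
Qed.

(** Identity principle: it carries a relation known at actual surface parameters to values of s that
    no parameter attains. *)
Lemma ratfun_vanishing_right f b : ratfun f ->
  (forall a, b < a -> D.[a] != 0 -> f a = 0) ->
  forall a, D.[a] != 0 -> f a = 0.
Proof.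
move=> [n [F fF]] f0 a Da.
have /eqP : F * D = 0.
  apply: (@poly_vanishing_right R _ b) => c bc; rewrite !hornerM.
  have [->|Dc] := eqVneq D.[c] 0; first by rewrite mulr0.
  by rewrite -fF // f0 // !mul0r.
rewrite mulf_eq0 (negPf D_neq0) orbF => /eqP F0.
by apply: (mulIf (expf_neq0 n Da)); rewrite mul0r fF // F0 horner0.
Qed.

End RationalFunctions.

(** For each [y > 0], infinitely many [x] kill the coefficients of [p] at [y]; infinitely many [y]
    then kill the coefficients themselves. On this region (y / x)^2 < 1/4, which ensures [0 < k] in
    [no_quadratic_relation]. *)
Lemma poly2_eq0 (R : realDomainType) (p : {poly {poly R}}) :
  (forall x y, 0 < y -> x < - (2 * y) -> p.[x%:P].[y] = 0) -> p = 0.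
Proof.
move=> p0.
have hy y : 0 < y -> map_poly (horner_eval y) p = 0.
  move=> y_gt0; apply: (@poly_vanishing_left R _ (- (2 * y))) => x xy.
  have := p0 x y y_gt0 xy; rewrite -[X in X = _]/(horner_eval y p.[x%:P]).
  by rewrite -horner_map /= /horner_eval hornerC.
apply/polyP => i; rewrite coef0.
apply: (@poly_vanishing_right R _ 0) => y /hy /(congr1 (fun q : {poly R} => q`_i)).
by rewrite coef_map coef0.
Qed.

(** * Cancelling the leading coefficient *)

Section Cancellation.
Variables (S : idomainType) (g : {poly S}).

(** Multiplication by [a] is injective modulo [g]. *)
Definition cancellable (a : S) : Prop :=
  forall f q : {poly S}, a *: f = q * g -> exists q', f = q' * g.

Lemma cancellableM a b : cancellable a -> cancellable b -> cancellable (a * b).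
Proof. by move=> ca cb f q; rewrite -scalerA => /ca[q' /cb]. Qed.

Lemma cancellableX a n : cancellable a -> cancellable (a ^+ n).
Proof.
move=> ca; elim: n => [|n IHn]; last by rewrite exprS; apply: cancellableM.
by move=> f q; rewrite expr0 scale1r => ->; exists q.
Qed.

Lemma cancellable_unit a : a \is a GRing.unit -> cancellable a.
Proof.
move=> ua f q /(congr1 (fun p => a^-1 *: p)).
by rewrite scalerA mulVr // scale1r scalerAl => ->; exists (a^-1 *: q).
Qed.

End Cancellation.

(** Evaluation at [c] is reduction modulo the prime ['X - c%:P]. Since [g] survives this reduction,
    the cofactor [q] must reduce to zero, so that each of its coefficients is divisible. *)
Lemma cancellable_XsubC (K : idomainType) (g : {poly {poly K}}) (c : K) :
  map_poly (horner_eval c) g != 0 -> cancellable g ('X - c%:P).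
Proof.
move=> gc f q E.
have qc : map_poly (horner_eval c) q = 0.
  have := congr1 (map_poly (horner_eval c)) E.
  rewrite rmorphM /= map_polyZ /= {1}/horner_eval hornerXsubC subrr scale0r.
  by move/esym/eqP; rewrite mulf_eq0 (negPf gc) orbF => /eqP.
pose q' := \poly_(i < size q) Pdiv.Ring.rdivp q`_i ('X - c%:P).
have qE : q = ('X - c%:P) *: q'.
  apply/polyP => i; rewrite coefZ coef_poly; case: ltnP => [lt_i|].
  2: by move=> /(nth_default 0) ->; rewrite mulr0.
  have : root q`_i c.
    by apply/rootP; have := congr1 (fun p : {poly K} => p`_i) qc; rewrite coef_map coef0.
  rewrite -Pdiv.Ring.rdvdp_XsubCl => /Pdiv.Ring.rmodp_eq0 r0.
  by rewrite [LHS](Pdiv.RingMonic.rdivp_eq (monicXsubC c)) r0 addr0 mulrC.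
exists q'; move: E; rewrite qE -scalerAl -!mul_polyC; apply: mulfI.
by rewrite polyC_eq0 polyXsubC_eq0.
Qed.

(** * Trivariate polynomials as iterated univariate ones *)

Lemma mpoly_rmorph_ext (n : nat) (R A : comNzRingType)
    (f g : {rmorphism {mpoly R[n]} -> A}) :
  (forall c, f c%:MP = g c%:MP) -> (forall i, f 'X_i = g 'X_i) -> f =1 g.
Proof.
move=> fgC fgX p; rewrite (mpolyE p) !rmorph_sum /=; apply: eq_bigr => m _.
rewrite -mul_mpolyC !rmorphM fgC mpolyXE_id !rmorph_prod; congr (_ * _).
by apply: eq_bigr => i _; rewrite !rmorphXn /= fgX.
Qed.

Lemma ord3_ind (P : 'I_3 -> Prop) :
  P (inord 0) -> P (inord 1) -> P (inord 2) -> forall i, P i.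
Proof.
move=> P0 P1 P2 i; rewrite -(inord_val i).
by case: i => -[|[|[|]]].
Qed.

Lemma commr_rmorph_com (A : nzRingType) (B : comNzRingType)
    (f : {rmorphism A -> B}) (u : B) : commr_rmorph f u.
Proof. by move=> a; apply: mulrC. Qed.

Section TowerOfPolynomials.
Variable R : realType.
Local Notation S := {poly {poly R}}.
Local Notation T := {poly S}.

(* The outermost variable is w, the middle one is x and the innermost one is y. *)
Definition tower_var (i : 'I_3) : T := [:: ('X)%:P; ('X)%:P%:P; 'X]`_i.

(** Pseudo-division in w becomes available once w is the only variable over an integral domain. *)
Definition tower : {mpoly R[3]} -> T :=
  mmap ((@polyC S) \o ((@polyC {poly R}) \o (@polyC R))) tower_var.

HB.instance Definition _ := GRing.RMorphism.on tower.

Definition untower_y : {rmorphism {poly R} -> {mpoly R[3]}} :=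
  horner_morph (commr_rmorph_com (@mpolyC 3 R) 'X_(inord 1)).

Definition untower_x : {rmorphism S -> {mpoly R[3]}} :=
  horner_morph (commr_rmorph_com untower_y 'X_(inord 0)).

Definition untower : {rmorphism T -> {mpoly R[3]}} :=
  horner_morph (commr_rmorph_com untower_x 'X_(inord 2)).

Definition eval3 (x y w : R) : T -> R :=
  horner_eval y \o (horner_eval x%:P \o horner_eval w%:P%:P).

HB.instance Definition _ x y w := GRing.RMorphism.on (eval3 x y w).

Lemma eval3E x y w p : eval3 x y w p = p.[w%:P%:P].[x%:P].[y].
Proof. by []. Qed.

Lemma towerC c : tower c%:MP = c%:P%:P%:P.
Proof. exact: mmapC. Qed.

Lemma towerX i : tower 'X_i = tower_var i.
Proof. by rewrite /tower mmapX mmap1U. Qed.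

(** Carries a factorization found in the tower back to [{mpoly R[3]}]; it suffices to compare two
    morphisms on constants and variables. *)
Lemma towerK : cancel tower untower.
Proof.
move=> p; rewrite -[LHS]/((untower \o tower) p) -[RHS]/(idfun p).
apply: mpoly_rmorph_ext => [c|i] /=.
  by rewrite towerC; do 3! rewrite horner_morphC /=.
rewrite towerX; elim/ord3_ind: i; rewrite /tower_var inordK //=;
  by do ?[rewrite horner_morphC /= | rewrite horner_morphX /=].
Qed.

Lemma eval3_tower x y w p (v : 'I_3 -> R) :
  v (inord 0) = x -> v (inord 1) = y -> v (inord 2) = w ->
  p.@[v] = eval3 x y w (tower p).
Proof.
move=> vx vy vw.
rewrite -[RHS]/((eval3 x y w \o tower) p).
apply: mpoly_rmorph_ext => [c|i] /=.
  by rewrite towerC mevalC eval3E !hornerC.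
rewrite towerX mevalXU; elim/ord3_ind: i;
  by rewrite /tower_var inordK //= eval3E ?hornerX ?hornerC ?hornerX ?hornerC ?hornerX.
Qed.
End TowerOfPolynomials.

(** * Bounds on the total degree *)

Section MpolySize.
Variables (n : nat) (R : idomainType).

Lemma msize_le_sum (p q : {mpoly R[n]}) d :
  (msize p <= d)%N -> (msize q <= d)%N -> (msize (p + q) <= d)%N.
Proof. by move=> pd qd; rewrite (leq_trans (msizeD_le p q)) // geq_max pd. Qed.

Lemma msize_le_mul (p q : {mpoly R[n]}) d e :
  (msize p <= d.+1)%N -> (msize q <= e.+1)%N -> (msize (p * q) <= (d + e).+1)%N.
Proof.
have [->|p0] := eqVneq p 0; first by rewrite mul0r msize0.
have [->|q0] := eqVneq q 0; first by rewrite mulr0 msize0.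
move=> pd qe; rewrite msizeM //; move: (leq_add pd qe); rewrite addSn addnS.
by case: (_ + _)%N.
Qed.

Lemma msize_le_exp (p : {mpoly R[n]}) d k :
  (msize p <= d.+1)%N -> (msize (p ^+ k) <= (k * d).+1)%N.
Proof.
move=> pd; elim: k => [|k IHk]; first by rewrite expr0 msize1.
by rewrite exprS mulSn msize_le_mul.
Qed.

Lemma msize_le_nat k : (msize (k%:R : {mpoly R[n]}) <= 1)%N.
Proof. by rewrite -[k%:R](rmorph_nat (@mpolyC n R)) msizeC leq_b1. Qed.

Lemma mpoly_unitP (p : {mpoly R[n]}) :
  p \is a GRing.unit -> exists2 c, c != 0 & p = c%:MP.
Proof.
move=> up; apply/msize_poly1P.
have p0 : p != 0 by apply: contraTneq up => ->; rewrite unitr0.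
have q0 : p^-1 != 0 by rewrite invr_eq0.
have := msizeM p0 q0; rewrite divrr // msize1.
rewrite -!(msize_poly_eq0) in p0 q0.
by case: (msize p) p0 (msize _) q0 => [|[|a]] // _ [|b] // _; rewrite addSn addnS.
Qed.

(** Restriction to the line through the origin directed by [a] does not raise the degree, so a
    univariate computation bounds [msize] from below. *)
Lemma size_mmap_line (a : 'I_n -> R) (p : {mpoly R[n]}) :
  (size (mmap (@polyC R) (fun i => ((a i)%:P * 'X)%R) p) <= msize p)%N.
Proof.
rewrite /mmap; apply: (leq_trans (size_sum _ _ _)); apply/bigmax_leqP_seq => m mp _.
apply: leq_trans (msize_mdeg_lt mp).
rewrite /mmap1; under eq_bigr => i _ do rewrite exprMn -rmorphXn.
rewrite big_split /= -rmorph_prod prodrXr -mdegE mulrA -rmorphM mul_polyC.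
by rewrite (leq_trans (size_scale_leq _ _)) // size_polyXn.
Qed.

End MpolySize.

(** * The tangential coordinates of Bour's surface *)

(* bour3_poly over an arbitrary ring: morphism lemmas can then be rewritten with
   in an abstract ring, where numerals and powers do not unfold. *)
Definition bour3_expr (A : comNzRingType) (u v w : A) : A :=
  9 * u ^+ 8 + 72 * u ^+ 7 + 144 * u ^+ 6 + 288 * u ^+ 5 * w ^+ 2
  + 192 * u ^+ 3 * w ^+ 4 + 8 * u ^+ 6 * w ^+ 2
  - 48 * u ^+ 4 * v ^+ 2 * w ^+ 2 - 576 * u * v ^+ 2 * w ^+ 4
  + 81 * u ^+ 2 * v ^+ 6 + 432 * u ^+ 4 * v ^+ 2 - 45 * u ^+ 6 * v ^+ 2
  - 72 * u ^+ 5 * v ^+ 2 + 432 * u ^+ 2 * v ^+ 4 - 360 * u ^+ 3 * v ^+ 4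
  - 216 * u * v ^+ 6 + 27 * u ^+ 4 * v ^+ 4
  + 144 * v ^+ 6 - 576 * u ^+ 3 * v ^+ 2 * w ^+ 2
  + 72 * u ^+ 2 * v ^+ 4 * w ^+ 2 - 864 * u * v ^+ 4 * w ^+ 2.

Lemma bour3_polyE (R : realType) :
  bour3_poly R = bour3_expr 'X_(inord 0) 'X_(inord 1) 'X_(inord 2).
Proof. by []. Qed.

(** The factor [u * (u ^+ 2 - 3 * v ^+ 2)] is the real part of (u + iv)^3, a product of three real
    linear forms. *)
Definition bour3_lead (A : comNzRingType) (u v : A) : A :=
  192 * u * (u ^+ 2 - 3 * v ^+ 2).

Definition bour3_mid (A : comNzRingType) (u v : A) : A :=
  8 * u ^+ 2 * (u ^+ 2 - 3 * v ^+ 2) ^+ 2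
  + 288 * u * (u ^+ 2 - 3 * v ^+ 2) * (u ^+ 2 + v ^+ 2).

Definition bour3_const (A : comNzRingType) (u v : A) : A :=
  9 * u ^+ 2 * (u ^+ 2 - 3 * v ^+ 2) ^+ 2 * (u ^+ 2 + v ^+ 2)
  + 72 * u * (u ^+ 2 - 3 * v ^+ 2) * (u ^+ 2 + v ^+ 2) ^+ 2
  + 144 * (u ^+ 2 + v ^+ 2) ^+ 3.

Lemma bour3_exprE (A : comNzRingType) (u v w : A) :
  bour3_expr u v w =
  bour3_lead u v * w ^+ 4 + bour3_mid u v * w ^+ 2 + bour3_const u v.
Proof. rewrite /bour3_expr /bour3_lead /bour3_mid /bour3_const; ring. Qed.

Section BourMorphism.
Variables (A B : comNzRingType) (f : {rmorphism A -> B}).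
Implicit Types u v w : A.

(* rmorph_nat and rmorphXn come first: the other rules match numerals and powers
   up to unfolding. *)
Lemma rmorph_bour3_lead u v : f (bour3_lead u v) = bour3_lead (f u) (f v).
Proof.
by rewrite /bour3_lead !(rmorph_nat, rmorphXn, rmorphD, rmorphN, rmorphM).
Qed.

Lemma rmorph_bour3_mid u v : f (bour3_mid u v) = bour3_mid (f u) (f v).
Proof.
by rewrite /bour3_mid !(rmorph_nat, rmorphXn, rmorphD, rmorphN, rmorphM).
Qed.

Lemma rmorph_bour3_const u v : f (bour3_const u v) = bour3_const (f u) (f v).
Proof.
by rewrite /bour3_const !(rmorph_nat, rmorphXn, rmorphD, rmorphN, rmorphM).
Qed.

Lemma rmorph_bour3_expr u v w :
  f (bour3_expr u v w) = bour3_expr (f u) (f v) (f w).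
Proof.
rewrite !bour3_exprE 2!rmorphD !(rmorphM f _ (w ^+ _)) !rmorphXn /=.
by rewrite rmorph_bour3_lead rmorph_bour3_mid rmorph_bour3_const.
Qed.

End BourMorphism.

Section BourSurface.
Variable R : realType.
Implicit Types u v : R.

Local Notation P := (tangentP (@bour3 R) (@bour3_gauss R)).
Local Notation coord := (tangential_coords (@bour3 R) (@bour3_gauss R)).

Lemma sqr_sum_succ_neq0 u v : u ^+ 2 + v ^+ 2 + 1 != 0.
Proof. by rewrite gt_eqF //; nra. Qed.

Lemma sqr_sum_succ2_neq0 u v : u ^+ 2 + v ^+ 2 + 2 != 0.
Proof. by rewrite gt_eqF //; nra. Qed.

Lemma tangentP_bour3 u v :
  P u v = - (u * (u ^+ 2 - 3 * v ^+ 2) * (u ^+ 2 + v ^+ 2 + 2))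
          / (6 * (u ^+ 2 + v ^+ 2 + 1)).
Proof.
rewrite /tangentP !big_ord_recl big_ord0 !mxE /=.
field; exact: sqr_sum_succ_neq0.
Qed.

Lemma tangentP_bour3_neq0 u v :
  (P u v != 0) = (u != 0) && (u ^+ 2 - 3 * v ^+ 2 != 0).
Proof.
rewrite tangentP_bour3 mulf_eq0 oppr_eq0 invr_eq0 !mulf_eq0.
by rewrite (negPf (sqr_sum_succ_neq0 u v)) (negPf (sqr_sum_succ2_neq0 u v))
  pnatr_eq0 !orbF negb_or.
Qed.

Lemma coord_bour3 u v : P u v != 0 ->
  [/\ coord u v (inord 0) = - 12 / ((u ^+ 2 - 3 * v ^+ 2) * (u ^+ 2 + v ^+ 2 + 2)),
      coord u v (inord 1) = - 12 * v / (u * (u ^+ 2 - 3 * v ^+ 2) * (u ^+ 2 + v ^+ 2 + 2))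
    & coord u v (inord 2) = - 6 * (u ^+ 2 + v ^+ 2 - 1)
        / (u * (u ^+ 2 - 3 * v ^+ 2) * (u ^+ 2 + v ^+ 2 + 2))].
Proof.
move=> Puv; move: (Puv); rewrite tangentP_bour3_neq0 => /andP[u0 k0].
have s1 := sqr_sum_succ_neq0 u v; have s2 := sqr_sum_succ2_neq0 u v.
by split; rewrite /tangential_coords tangentP_bour3 !mxE inordK //=; field;
   rewrite u0 k0 s1 s2.
Qed.

Lemma bour3_poly_vanishes : vanishes_on_tangential (@bour3 R) (@bour3_gauss R) (bour3_poly R).
Proof.
move=> u v Puv; have [e0 e1 e2] := coord_bour3 Puv.
rewrite bour3_polyE rmorph_bour3_expr /= !mevalXU /bour3_expr.
move: (Puv); rewrite tangentP_bour3_neq0 => /andP[u0 k0].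
have s2 := sqr_sum_succ2_neq0 u v.
pose s := u ^+ 2 + v ^+ 2.
have s0 : s != 0 by rewrite gt_eqF // ltr_wpDr ?sqr_ge0 // exprn_even_gt0.
set x := coord u v (inord 0); set y := coord u v (inord 1).
set w := coord u v (inord 2).
pose e := 1 + (v / u) ^+ 2.
pose z := (1 - 3 * (v / u) ^+ 2) * x.
pose b := (s - 1) / (2 * u).
have -> : y = v / u * x by rewrite /y e1 /x e0; field; rewrite u0 k0 s2.
have -> : w = b * x by rewrite /w e2 /x e0 /b /s; field; rewrite u0 k0 s2.
(* Both [y] and [w] are now multiples of [x]. The terms with [z ^+ 2], with [z] and without [z] come
   from the homogeneous parts of degree 8, 7 and 6. *)
transitivity (x ^+ 6 * (z ^+ 2 * (9 * e + 8 * b ^+ 2)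
   + 24 * z * (3 * e ^+ 2 + 12 * e * b ^+ 2 + 8 * b ^+ 4) + 144 * e ^+ 3)).
  by rewrite /z /e; ring.
(* Once [z] and [b ^+ 2] are written through [e] and [s], every term carries the factor [e ^+ 3],
   and an identity in [s] alone remains. *)
have -> : z = - 12 * e / (s * (s + 2)).
  by rewrite /z /x e0 /e /s; field; rewrite u0 k0 s2 s0.
have b2 : b ^+ 2 = e * (s - 1) ^+ 2 / (4 * s).
  by rewrite /b /e /s; field; rewrite u0 s0.
have -> : b ^+ 4 = (b ^+ 2) ^+ 2 by ring.
by rewrite b2; field; rewrite s0 s2.
Qed.

(** * The vanishing ideal *)

(** The relation is assumed only where w is nonzero, because the odd part of a remainder has to be
    divided by w first. *)
Lemma no_quadratic_relation (a b : {poly {poly R}}) :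
  (forall u v, P u v != 0 -> coord u v (inord 2) != 0 ->
     a.[(coord u v (inord 0))%:P].[coord u v (inord 1)]
     + b.[(coord u v (inord 0))%:P].[coord u v (inord 1)]
       * coord u v (inord 2) ^+ 2 = 0) ->
  a = 0 /\ b = 0.
Proof.
move=> ab0.
suff ab x y : 0 < y -> x < - (2 * y) -> a.[x%:P].[y] = 0 /\ b.[x%:P].[y] = 0.
  by split; apply: poly2_eq0 => x y y0 xy; case: (ab x y y0 xy).
move=> y0 xy; have x0 : x < 0 by lra.
have xn0 : x != 0 by rewrite lt_eqF.
pose t := y / x; have yE : y = t * x by rewrite /t divfK.
pose e := 1 + t ^+ 2; pose k := 1 - 3 * t ^+ 2.
have e0 : 0 < e by rewrite /e; nra.
have k0 : 0 < k.
  have : 2 * y ^+ 2 < x ^+ 2 * (1/2) by nra.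
  by rewrite /k yE exprMn; have := sqr_ge0 x; nra.
have en0 : e != 0 by rewrite gt_eqF.
have kn0 : k != 0 by rewrite gt_eqF.
pose c := - 12 * e / k.
have c0 : c < 0 by rewrite /c pmulr_llt0 ?invr_gt0 //; lra.
pose D : {poly R} := 'X * ('X + 2%:P).
have DE s : D.[s] = s * (s + 2) by rewrite /D hornerM hornerD hornerX hornerC.
have Dn0 : D != 0.
  by apply/negP => /eqP D0; have := DE 1; rewrite D0 horner0; lra.
(* [f s], [t * f s] and [q s] are x, y and w^2 at a parameter with v / u = t and u^2 + v^2 = s. *)
pose f s := c / D.[s].
pose q s := f s * f s * ((e / 4 * (s - 1) ^+ 2 * (s + 2)) / D.[s]).
pose F s := a.[(f s)%:P].[t * f s] + b.[(f s)%:P].[t * f s] * q s.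
have rf : ratfun D f by apply: (@ratfun_div _ _ c%:P) => s _; rewrite hornerC.
have rtf : ratfun D (fun s => t * f s) by apply: ratfunM => //; apply: ratfunC.
have rq : ratfun D q.
  apply: ratfunM; first exact: ratfunM.
  apply: (@ratfun_div _ _ ((e / 4)%:P * ('X - 1) ^+ 2 * ('X + 2%:P))) => s _.
  by rewrite !hornerE.
have rF : ratfun D F.
  by apply: ratfunD; last apply: ratfunM => //; apply: ratfun_horner2.
have F0 : forall s, D.[s] != 0 -> F s = 0.
  (* Each s > 1 comes from the real parameter ([u], [t * u]), where w is nonzero since s is not
     1. *)
  apply: (@ratfun_vanishing_right _ _ Dn0 F 1 rF) => s s1 _.
  pose u := Num.sqrt (s / e).
  have s0 : 0 < s by lra.
  have u2 : u ^+ 2 = s / e by rewrite sqr_sqrtr // divr_ge0 // ltW.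
  have un0 : u != 0 by rewrite gt_eqF // sqrtr_gt0 divr_gt0.
  have uk : u ^+ 2 - 3 * (t * u) ^+ 2 = k * s / e.
    by rewrite exprMn u2 /k; field.
  have us : u ^+ 2 + (t * u) ^+ 2 = s.
    by rewrite exprMn u2 /e; field.
  have Pn0 : P u (t * u) != 0.
    rewrite tangentP_bour3_neq0 un0 uk.
    by rewrite !mulf_neq0 ?invr_eq0 // gt_eqF.
  have [E0 E1 E2] := coord_bour3 Pn0.
  rewrite uk us in E0 E1 E2.
  have sn0 : s != 0 by rewrite gt_eqF.
  have s2n0 : s + 2 != 0 by rewrite gt_eqF //; lra.
  have s1n0 : s - 1 != 0 by rewrite gt_eqF //; lra.
  have := ab0 _ _ Pn0.
  have -> : coord u (t * u) (inord 0) = f s.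
    by rewrite E0 /f DE /c; field; rewrite en0 kn0 sn0 s2n0.
  have -> : coord u (t * u) (inord 1) = t * f s.
    by rewrite E1 /f DE /c; field; rewrite en0 kn0 sn0 s2n0 un0.
  rewrite E2 => <-.
    congr (_ + _ * _); rewrite /q /f DE /c.
    rewrite expr_div_n !exprMn u2.
    by field; rewrite en0 kn0 sn0 s2n0.
  by rewrite !mulf_neq0 ?invr_eq0 ?mulf_neq0 ?invr_eq0 ?oppr_eq0 ?pnatr_eq0.
(* This is the positive root of s (s + 2) = c / x. The other root is - 2 - s, so both give back the
   prescribed [x] and [y]. *)
pose s := Num.sqrt (1 + c / x) - 1.
have cx0 : 0 < c / x by rewrite -mulrNN -invrN divr_gt0 // oppr_gt0.
have s2 : (s + 1) ^+ 2 = 1 + c / x by rewrite /s subrK sqr_sqrtr //; lra.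
have s0 : 0 < s.
  by rewrite /s subr_gt0 -[ltLHS]sqrtr1 ltr_sqrt; lra.
have Ds : D.[s] = c / x by rewrite DE -[RHS](addKr 1) -s2; ring.
have Ds' : D.[- 2 - s] = c / x by rewrite -Ds !DE; ring.
have cxn0 : c / x != 0 by rewrite gt_eqF.
have fs : f s = x by rewrite /f Ds; field; rewrite xn0 lt_eqF.
have fs' : f (- 2 - s) = x by rewrite /f Ds' -Ds.
have := F0 s; have := F0 (- 2 - s).
rewrite /F fs fs' Ds Ds' -yE => /(_ cxn0) H1 /(_ cxn0) H2.
(* [q] is nonnegative at [s] and negative at [- 2 - s]; subtracting the two relations then isolates
   [b]. *)
have q12 : q s - q (- 2 - s) != 0.
  rewrite /q fs fs' Ds' Ds -Ds DE -mulrBr mulf_neq0 ?mulf_neq0 //.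
  rewrite -mulrBl mulf_neq0 ?invr_eq0 -?DE ?Ds // gt_eqF //.
  suff -> : e / 4 * (s - 1) ^+ 2 * (s + 2) - e / 4 * (- 2 - s - 1) ^+ 2 * (- 2 - s + 2)
    = e / 4 * ((s - 1) ^+ 2 * (s + 2) + (s + 3) ^+ 2 * s).
    apply: mulr_gt0; first by rewrite divr_gt0.
    have : 0 <= (s - 1) ^+ 2 * (s + 2) by rewrite mulr_ge0 ?sqr_ge0 //; lra.
    have : 0 < (s + 3) ^+ 2 * s by rewrite mulr_gt0 // exprn_gt0 //; lra.
    lra.
  by ring.
have b0 : b.[x%:P].[y] = 0.
  by apply: (mulIf q12); rewrite mul0r mulrBr; lra.
by split=> //; move: H1; rewrite b0 mul0r addr0.
Qed.

(** * Generator and primality of the vanishing ideal *)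

Local Notation vanishes := (vanishes_on_tangential (@bour3 R) (@bour3_gauss R)).
Local Notation G := (tower (bour3_poly R)).
Local Notation S := {poly {poly R}}.
Local Notation A := (bour3_lead 'X 'X%:P : S).

Lemma tower_bour3 : G = bour3_expr ('X)%:P ('X%:P)%:P 'X.
Proof.
have X0 : tower 'X_(inord 0) = ('X)%:P :> {poly S} by rewrite towerX /tower_var inordK.
have X1 : tower 'X_(inord 1) = ('X%:P)%:P :> {poly S} by rewrite towerX /tower_var inordK.
have X2 : tower 'X_(inord 2) = 'X :> {poly S} by rewrite towerX /tower_var inordK.
rewrite bour3_polyE -X0 -X1 -X2.
exact: (rmorph_bour3_expr (@tower R : {rmorphism _ -> _})).
Qed.

Lemma bour3_lead_neq0 : A != 0.
Proof.
apply/eqP => A0.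
have := rmorph_bour3_lead (horner_eval 0 \o horner_eval 1%:P : {rmorphism S -> R}) 'X 'X%:P.
rewrite A0 rmorph0 /= /horner_eval !hornerE /bour3_lead => /esym/eqP; apply/negP.
by rewrite (_ : _ * _ = 192) ?pnatr_eq0 //; ring.
Qed.

Lemma tower_bour3_Poly :
  G = [:: bour3_const 'X 'X%:P; 0; bour3_mid 'X 'X%:P; 0; A] :> seq S.
Proof.
set s : seq S := RHS.
rewrite -(@PolyK _ 0 s) /s; last exact: bour3_lead_neq0.
congr polyseq; rewrite tower_bour3 bour3_exprE.
rewrite -(rmorph_bour3_lead (@polyC S : {rmorphism S -> {poly S}})).
rewrite -(rmorph_bour3_mid (@polyC S : {rmorphism S -> {poly S}})).
rewrite -(rmorph_bour3_const (@polyC S : {rmorphism S -> {poly S}})).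
rewrite [RHS]/Poly [RHS]/= !cons_poly_def !polyC0; ring.
Qed.

Lemma vanishes_tower h u v : vanishes h -> P u v != 0 ->
  eval3 (coord u v (inord 0)) (coord u v (inord 1)) (coord u v (inord 2)) (tower h) = 0.
Proof.
by move=> vh Puv; rewrite -(eval3_tower h (erefl _) (erefl _) (erefl _)) vh.
Qed.

(** [P] and the first two components of the Gauss map are odd in the parameters, while the third
    component is even. *)
Lemma coord_bour3_opp u v : P u v != 0 ->
  [/\ P (- u) (- v) != 0,
      coord (- u) (- v) (inord 0) = coord u v (inord 0),
      coord (- u) (- v) (inord 1) = coord u v (inord 1)
    & coord (- u) (- v) (inord 2) = - coord u v (inord 2)].
Proof.
move=> Puv; have Puv' : P (- u) (- v) != 0.
  by move: Puv; rewrite !tangentP_bour3_neq0 oppr_eq0 !sqrrN.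
have [-> -> ->] := coord_bour3 Puv; have [-> -> ->] := coord_bour3 Puv'.
move: Puv; rewrite tangentP_bour3_neq0 => /andP[u0 k0].
have s2 := sqr_sum_succ2_neq0 u v.
by split=> //; rewrite ?sqrrN //; field; rewrite u0 k0 s2.
Qed.

Lemma vanishing_cubic_eq0 (r : {poly S}) : (size r <= 4)%N ->
  (forall u v, P u v != 0 ->
     eval3 (coord u v (inord 0)) (coord u v (inord 1)) (coord u v (inord 2)) r = 0) ->
  r = 0.
Proof.
move=> sr r0.
have rE x y w : eval3 x y w r =
    ((r`_0).[x%:P].[y] + (r`_2).[x%:P].[y] * w ^+ 2)
    + w * ((r`_1).[x%:P].[y] + (r`_3).[x%:P].[y] * w ^+ 2).
  rewrite eval3E (horner_coef_wide _ sr) !big_ord_recl big_ord0 /=.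
  rewrite addr0 -!polyC_exp.
  by rewrite !(hornerD, hornerM, hornerC); ring.
have [r00 r20] : r`_0 = 0 /\ r`_2 = 0.
  apply: no_quadratic_relation => u v Puv _.
  have [Puv' E0 E1 E2] := coord_bour3_opp Puv.
  have := r0 _ _ Puv; have := r0 _ _ Puv'; rewrite E0 E1 E2 !rE sqrrN => H1 H2.
  lra.
have [r10 r30] : r`_1 = 0 /\ r`_3 = 0.
  apply: no_quadratic_relation => u v Puv w0.
  have [Puv' E0 E1 E2] := coord_bour3_opp Puv.
  have := r0 _ _ Puv; have := r0 _ _ Puv'; rewrite E0 E1 E2 !rE sqrrN => H1 H2.
  apply: (mulfI w0); rewrite mulr0; lra.
apply/polyP => i; rewrite coef0.
by case: i => [|[|[|[|i]]]] //; rewrite nth_default // (leq_trans sr).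
Qed.

(** At the point ([c.[1]], 1, 0) the condition kills every term of the polynomial except 144 (x^2 +
    y^2)^3, which is positive. Hence [G] is nonzero modulo ['X - c%:P]. *)
Lemma cancellable_bour3_root (c : {poly R}) :
  c.[1] * (c.[1] ^+ 2 - 3) = 0 -> cancellable G ('X - c%:P).
Proof.
move=> c1; apply: cancellable_XsubC; apply/eqP => Gc.
have := congr1 (horner_eval 1 \o horner_eval 0 : {rmorphism S -> R}) Gc.
rewrite tower_bour3 (rmorph_bour3_expr (map_poly (horner_eval c))).
rewrite rmorph_bour3_expr rmorph0 /= !map_polyC map_polyX /= /horner_eval.
rewrite !hornerE bour3_exprE !expr0n /= !mulr0 !add0r /bour3_const.
move/eqP; apply/negP.
have -> : forall a : R, 9 * a ^+ 2 * (a ^+ 2 - 3 * 1 ^+ 2) ^+ 2 * (a ^+ 2 + 1 ^+ 2)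
   + 72 * a * (a ^+ 2 - 3 * 1 ^+ 2) * (a ^+ 2 + 1 ^+ 2) ^+ 2 + 144 * (a ^+ 2 + 1 ^+ 2) ^+ 3
   = (a * (a ^+ 2 - 3)) * (9 * a * (a ^+ 2 - 3) * (a ^+ 2 + 1) + 72 * (a ^+ 2 + 1) ^+ 2)
     + 144 * (a ^+ 2 + 1) ^+ 3 by move=> a; ring.
rewrite c1 mul0r add0r gt_eqF // mulr_gt0 // exprn_gt0 // ltr_wpDl ?sqr_ge0 //.
Qed.

Lemma cancellable_bour3_lead : cancellable G A.
Proof.
pose c : {poly R} := (Num.sqrt 3)%:P * 'X.
have c2 : c ^+ 2 = 3 * 'X ^+ 2.
  by rewrite exprMn -rmorphXn /= sqr_sqrtr ?ler0n // rmorph_nat.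
have -> : A = 192 * ('X - 0%:P) * ('X - c%:P) * ('X - (- c)%:P).
  rewrite /bour3_lead -rmorphXn.
  transitivity (192 * 'X * ('X ^+ 2 - (c ^+ 2)%:P) : S).
    by rewrite c2 polyCM (rmorph_nat (@polyC {poly R})).
  by rewrite polyC0 polyCN rmorphXn /=; ring.
have c1 : c.[1] ^+ 2 - 3 = 0.
  by rewrite /c !hornerE sqr_sqrtr ?ler0n // subrr.
apply: cancellableM; first apply: cancellableM; first apply: cancellableM.
- apply: cancellable_unit.
  rewrite -(rmorph_nat (@polyC _ \o @polyC R)) rmorph_unit // unitfE pnatr_eq0 //.
- by apply: cancellable_bour3_root; rewrite horner0 mul0r.
- by apply: cancellable_bour3_root; rewrite c1 mulr0.
- by apply: cancellable_bour3_root; rewrite hornerN sqrrN c1 mulr0.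
Qed.

(** Together with [bour3_poly_vanishes], this makes [bour3_poly] a generator of the vanishing
    ideal. *)
Lemma vanishes_bour3_dvd h : vanishes h -> exists q, h = q * bour3_poly R.
Proof.
move=> vh.
have sG : size G = 5%N by rewrite tower_bour3_Poly.
have lG : lead_coef G = A by rewrite lead_coefE sG tower_bour3_Poly.
have G0 : G != 0 by rewrite -size_poly_eq0 sG.
have dE := Pdiv.Idomain.divp_eq (tower h) G.
have r0 : (tower h %% G = 0)%R.
  apply: vanishing_cubic_eq0 => [|u v Puv].
    by have := Pdiv.Idomain.ltn_modp (tower h) G; rewrite G0 sG.
  have step (l p q g r : {poly S}) (E : {rmorphism {poly S} -> R}) :
      l * p = q * g + r -> E p = 0 -> E g = 0 -> E r = 0.
    move=> lE p0 g0; rewrite -[r](addKr (q * g)) -lE.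
    by rewrite rmorphD rmorphN !rmorphM p0 g0 !mulr0 oppr0 addr0.
  rewrite -mul_polyC in dE.
  apply: (step _ _ _ _ _ (eval3 _ _ _ : {rmorphism _ -> R}) dE).
    exact: vanishes_tower.
  by apply: vanishes_tower => //; apply: bour3_poly_vanishes.
move: dE; rewrite r0 addr0 lG.
move=> /(cancellableX cancellable_bour3_lead)[q hq].
exists (untower R q); rewrite -[LHS](towerK h) hq rmorphM.
by rewrite /= towerK.
Qed.

(** If [b] is nonzero at one parameter, the line joining it to any other parameter reduces the claim
    to rational functions of one variable. Zeros of [P] met along the line do no harm. *)
Lemma vanishes_mul b c : vanishes (b * c) -> vanishes b \/ vanishes c.
Proof.
move=> vbc; have [|] := EM (vanishes b); first by left.
move=> /existsNP[u1 /existsNP[v1 /not_implyP[P1 /eqP b1]]]; right => u2 v2 P2.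
pose pu := u1%:P + (u2 - u1)%:P * 'X.
pose pv := v1%:P + (v2 - v1)%:P * 'X.
(* Up to a factor without zeros, [D] is [P] along the line; it is also a common denominator of the
   three coordinates. *)
pose D := pu * (pu ^+ 2 - 3%:P * pv ^+ 2) * (pu ^+ 2 + pv ^+ 2 + 2%:P).
have DE a : D.[a] = pu.[a] * (pu.[a] ^+ 2 - 3 * pv.[a] ^+ 2) * (pu.[a] ^+ 2 + pv.[a] ^+ 2 + 2).
  by rewrite /D !(hornerM, hornerD, hornerN, horner_exp, hornerC).
have PD a : (P pu.[a] pv.[a] != 0) = (D.[a] != 0).
  rewrite DE tangentP_bour3_neq0 mulf_eq0 (negPf (sqr_sum_succ2_neq0 _ _)) orbF.
  by rewrite mulf_eq0 negb_or.
have pu0 : pu.[0] = u1 by rewrite /pu !(hornerD, hornerM, hornerC, hornerX); ring.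
have pv0 : pv.[0] = v1 by rewrite /pv !(hornerD, hornerM, hornerC, hornerX); ring.
have pu1 : pu.[1] = u2 by rewrite /pu !(hornerD, hornerM, hornerC, hornerX); ring.
have pv1 : pv.[1] = v2 by rewrite /pv !(hornerD, hornerM, hornerC, hornerX); ring.
have D0 : D.[0] != 0 by rewrite -PD pu0 pv0.
have Dn0 : D != 0 by apply: contraNneq D0 => ->; rewrite horner0.
have rcoord i : ratfun D (fun a => coord pu.[a] pv.[a] i).
  elim/ord3_ind: i.
  - apply: (@ratfun_div _ _ ((-12)%:P * pu)) => a Da.
    have Pa := Da; rewrite -PD in Pa; have [-> _ _] := coord_bour3 Pa.
    move: Pa; rewrite tangentP_bour3_neq0 => /andP[u0 k0].
    have s2 := sqr_sum_succ2_neq0 pu.[a] pv.[a].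
    by rewrite DE hornerM hornerC; field; rewrite u0 k0 s2.
  - apply: (@ratfun_div _ _ ((-12)%:P * pv)) => a Da.
    have Pa := Da; rewrite -PD in Pa; have [_ -> _] := coord_bour3 Pa.
    by rewrite DE hornerM hornerC.
  - apply: (@ratfun_div _ _ ((-6)%:P * (pu ^+ 2 + pv ^+ 2 - 1))) => a Da.
    have Pa := Da; rewrite -PD in Pa; have [_ _ ->] := coord_bour3 Pa.
    by rewrite DE !(hornerM, hornerD, hornerN, horner_exp, hornerC).
have [b0|c0] := ratfun_mulf_eq0 Dn0 (ratfun_meval b rcoord) (ratfun_meval c rcoord)
    (fun a Da => etrans (esym (mevalM _ _ _)) (vbc _ _ (etrans (PD a) Da))).
  by case/eqP: b1; rewrite -pu0 -pv0 b0.
by rewrite -pu1 -pv1 c0 // -PD pu1 pv1.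
Qed.

(** * Irreducibility, uniqueness and degree *)

Lemma bour3_poly_neq0 : bour3_poly R != 0.
Proof.
apply/eqP => g0.
have := rmorph_bour3_expr (meval (fun i => [:: 1; 0; 0]`_i) : {rmorphism {mpoly R[3]} -> R})
  'X_(inord 0) 'X_(inord 1) 'X_(inord 2).
rewrite -bour3_polyE g0 rmorph0 /= !mevalXU !inordK //= bour3_exprE.
rewrite /bour3_lead /bour3_mid /bour3_const => /esym/eqP; apply/negP.
(* The value at (1, 0, 0) is 9 + 72 + 144, from the pure powers of the first variable. *)
by rewrite (_ : _ + _ = 225) ?pnatr_eq0 //; ring.
Qed.

Lemma bour3_poly_nunit : bour3_poly R \isn't a GRing.unit.
Proof.
apply/negP => /mpoly_unitP[c c0 gc].
have P10 : P 1 0 != 0.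
  by rewrite tangentP_bour3_neq0 expr1n expr0n /= mulr0 subr0 oner_eq0.
by have := bour3_poly_vanishes P10; rewrite gc mevalC => /eqP; rewrite (negPf c0).
Qed.

(** Primality puts one of the two factors in the vanishing ideal; that factor is a multiple of
    [bour3_poly], so the other one is a unit. *)
Lemma bour3_poly_irreducible : irreducible (bour3_poly R).
Proof.
split; [exact: bour3_poly_neq0 | exact: bour3_poly_nunit | move=> b c gE].
have unit_cofactor (p q : {mpoly R[3]}) : bour3_poly R = p * q -> vanishes p ->
    q \is a GRing.unit.
  move=> pq /vanishes_bour3_dvd[k kE]; move: pq; rewrite kE mulrAC.
  rewrite -[X in X = _]mul1r => /(mulIf bour3_poly_neq0) kq.
  by apply/unitrP; exists k; rewrite [q * k]mulrC -kq.
have := bour3_poly_vanishes; rewrite gE => /vanishes_mul[vb|vc]; [right|left].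
  exact: unit_cofactor vb.
by apply: unit_cofactor vc; rewrite mulrC.
Qed.

Lemma bour3_poly_equation : is_tangential_equation (@bour3 R) (@bour3_gauss R) (bour3_poly R).
Proof.
split; [exact: bour3_poly_irreducible | exact: bour3_poly_vanishes |].
move=> h [_ _ h_irr] /vanishes_bour3_dvd[k hE].
have [/mpoly_unitP[c c0 kc]|] := h_irr _ _ hE; last by rewrite (negPf bour3_poly_nunit).
by exists c => //; rewrite hE kc mul_mpolyC.
Qed.

Lemma msize_bour3_poly : msize (bour3_poly R) = 9%N.
Proof.
apply/eqP; rewrite eqn_leq; apply/andP; split.
  rewrite bour3_polyE bour3_exprE /bour3_lead /bour3_mid /bour3_const.
  set u := 'X_(inord 0); set v := 'X_(inord 1); set w := 'X_(inord 2).
  have X i d : (msize ('X_i ^+ d : {mpoly R[3]}) <= d.+1)%N.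
    by have := @msize_le_exp 3 R 'X_i 1 d; rewrite muln1 msizeX mdeg1; apply.
  have N k d : (msize (k%:R : {mpoly R[3]}) <= d.+1)%N.
    exact: leq_trans (msize_le_nat _ _ _) _.
  have k2 : (msize (u ^+ 2 - 3 * v ^+ 2) <= 3)%N.
    apply: msize_le_sum; first exact: X.
    by rewrite msizeN; apply: (@msize_le_mul _ _ _ _ 0 2) => //; apply: X.
  have e2 : (msize (u ^+ 2 + v ^+ 2) <= 3)%N by apply: msize_le_sum; apply: X.
  have M := @msize_le_mul 3 R; have E := @msize_le_exp 3 R.
  (* In [M _ _ d e] the two factors are allotted degrees [d] and [e]; terms of degree 6 or 7 get
     some slack, so that every total is 8. *)
  apply: msize_le_sum; first apply: msize_le_sum.
  - apply: (M _ _ 4 4); last exact: X.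
    by apply: (M _ _ 2 2) => //; apply: (M _ _ 1 1); [exact: N | exact: (X _ 1%N)].
  - apply: (M _ _ 6 2); last exact: X.
    apply: msize_le_sum.
      apply: (M _ _ 2 4); last exact: (E _ 2).
      by apply: (M _ _ 0 2); [exact: N | exact: X].
    apply: (M _ _ 4 2) => //; apply: (M _ _ 2 2) => //.
    by apply: (M _ _ 1 1); [exact: N | exact: (X _ 1%N)].
  apply: msize_le_sum; first apply: msize_le_sum.
  - apply: (M _ _ 6 2) => //; apply: (M _ _ 2 4); last exact: (E _ 2).
    by apply: (M _ _ 0 2); [exact: N | exact: X].
  - apply: (M _ _ 4 4); last exact: (E _ 2).
    apply: (M _ _ 2 2) => //.
    by apply: (M _ _ 1 1); [exact: N | exact: (X _ 1%N)].
  by apply: (M _ _ 2 6); [exact: N | exact: (E _ 2)].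
(* For the lower bound, on the line spanned by (1, 0, 0) the coefficient of degree 8 is 9. *)
apply: leq_trans (size_mmap_line (fun i => [:: 1; 0; 0]`_i) _).
set f := mmap _ _.
have := rmorph_bour3_expr (f : {rmorphism {mpoly R[3]} -> {poly R}})
  'X_(inord 0) 'X_(inord 1) 'X_(inord 2).
rewrite -bour3_polyE /= /f !mmapX !mmap1U !inordK //= polyC0 polyC1 mul1r !mul0r => ->.
rewrite ltnNge; apply/negP => /(nth_default 0).
have -> : bour3_expr 'X 0 0 = 9 *: 'X^8 + 72 *: 'X^7 + 144 *: 'X^6 :> {poly R}.
  rewrite bour3_exprE /bour3_lead /bour3_mid /bour3_const -!mul_polyC.
  by rewrite !(rmorph_nat (@polyC R)); ring.
by rewrite !coefD !coefZ !coefXn /= !mulr0 !addr0 mulr1 => /eqP; rewrite pnatr_eq0.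
Qed.

End BourSurface.


Theorem mainTheorem2 (R : realType) :
  is_tangential_equation (@bour3 R) (@bour3_gauss R) (bour3_poly R) /\
  surface_class (@bour3 R) (@bour3_gauss R) = 8%N.
Proof.
have eqg := bour3_poly_equation R; split=> //.
rewrite /surface_class.
(* Whichever equation [xget] picks is a nonzero constant multiple of [bour3_poly], hence has the
   same [msize]. *)
case: xgetP => [g _ [g_irr g_van _]|/(_ (bour3_poly R))]; last by [].
have [_ _ /(_ _ g_irr g_van)[c c0 ->]] := eqg.
by rewrite msizeZ // msize_bour3_poly.
Qed.
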